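(* Let $V$ be a finite set, $f:2^V\to\mathbb{R}_+$ a nondecreasing submodular function and $g:2^V\to\mathbb{R}_+$ a nondecreasing supermodular function. For a budget $B$ let $\mathrm{OPT}_P(B)=\max_{T:\,g(T)\le B} f(T)$. Suppose $\mathcal{A}$ is an algorithm which, for any budget $B$, returns a set $S=\mathcal{A}(B)$ with $f(S)\ge\alpha\cdot\mathrm{OPT}_P(B)$ and $g(S)\le\beta B$. Let $\tau>0$ and $B^*=\min_{T:\,f(T)\ge\tau} g(T)$. Then, by performing binary search on $B$ with additive precision $\varepsilon>0$ (calling $\mathcal{A}$ at each probed budget and testing whether the returned set $S$ satisfies $f(S)\ge\alpha\tau$), one can find a set $S$ such that $$f(S)\ge\alpha\tau\qquad\text{and}\qquad g(S)\le\beta\Bigl(1+\frac{\varepsilon}{B^*}\Bigr)B^*.$$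
   Context: Submodular: $f(A\cup\{e\})-f(A)\ge f(B\cup\{e\})-f(B)$ for all $A\subseteq B\subseteq V$, $e\in V\setminus B$; supermodular: the reverse inequality. The binary search maintains an interval $[L,R]$ initialized to $[0,g(V)]$; while $R-L>\varepsilon$ it sets $B=(L+R)/2$, computes $S=\mathcal{A}(B)$, and if $f(S)\ge\alpha\tau$ sets $R\leftarrow B$ and records $S$ as the best set, else sets $L\leftarrow B$; it returns the recorded best set.
   Formalization: If no probed budget passes the test, or none is probed (e.g. g(V) ≤ ε), the binary search records no set and its output is undefined; in that case the formal version returns A(g(V)), the algorithm called at the initial right endpoint. *)

(* Defs.v *)
From HB Require Import structures.
From mathcomp Require Import all_boot all_order all_algebra.
From mathcomp Require Import reals.

Set Implicit Arguments.
Unset Strict Implicit.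
Unset Printing Implicit Defensive.

Import Order.TTheory GRing.Theory Num.Theory.
Local Open Scope ring_scope.

Section SetFunctions.
Variables (R : realType) (V : finType).
Implicit Types (f g : {set V} -> R) (A B : {set V}).

Definition nonneg_fun f := forall A, 0 <= f A.

Definition nondecreasing_fun f := forall A B, A \subset B -> f A <= f B.

Definition submodular f := forall A B (e : V), A \subset B -> e \notin B ->
  f (A :|: [set e]) - f A >= f (B :|: [set e]) - f B.

Definition supermodular g := forall A B (e : V), A \subset B -> e \notin B ->
  g (A :|: [set e]) - g A <= g (B :|: [set e]) - g B.

(* For nonnegative f this is the maximum whenever some T satisfies g T <= B;
   it is 0 when no T does. *)
Definition OPT f g (B : R) : R :=
  \big[Num.max/0]_(T : {set V} | g T <= B) f T.

(* For nondecreasing f and g this is the minimum whenever some T satisfies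
   tau <= f T, since V itself then does and has the largest cost. *)
Definition min_cost f g (tau : R) : R :=
  \big[Num.min/g [set: V]]_(T : {set V} | tau <= f T) g T.

Definition bicriteria f g (alpha beta : R) (alg : R -> {set V}) :=
  forall B : R, 0 <= B ->
    alpha * OPT f g B <= f (alg B) /\ g (alg B) <= beta * B.

End SetFunctions.

Section BinarySearch.
Variables (R : realType) (V : finType).
Variables (f g : {set V} -> R) (alpha tau eps : R) (alg : R -> {set V}).

Record search_state := SearchState {
  lo : R;
  hi : R;
  best : option {set V}
}.

Definition search_init := SearchState 0 (g [set: V]) None.

Definition search_step (s : search_state) : search_state :=
  let B := (lo s + hi s) / 2 in
  let X := alg B in
  if alpha * tau <= f X then SearchState (lo s) B (Some X)
  else SearchState B (hi s) (best s).

(* search_run s s' : the while loop started in s terminates in s'. The loop is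
   deterministic, so there is at most one such s'. *)
Inductive search_run : search_state -> search_state -> Prop :=
| search_stop s : hi s - lo s <= eps -> search_run s s
| search_loop s s' : eps < hi s - lo s ->
    search_run (search_step s) s' -> search_run s s'.

(* If no probe succeeded (or none was made), nothing has been recorded and the
   right endpoint is still the initial g V; alg is then called there. *)
Definition search_output (s : search_state) : {set V} :=
  if best s is Some X then X else alg (hi s).

End BinarySearch.

(* Main.v *)
(** A probe at a budget [B >= B*] always succeeds, because then
    [OPT_P(B) >= tau]. Hence the left endpoint, which moves only to failed
    probes, never exceeds [B*], while the right endpoint always bounds the
    output's cost: [g(S) <= beta * R]. At termination
    [R <= L + eps <= B* + eps]. *)
Require Import Defs.
From HB Require Import structures.
From mathcomp Require Import all_boot all_order all_algebra.
From mathcomp Require Import reals.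
From mathcomp Require Import ring lra.

Set Implicit Arguments.
Unset Strict Implicit.
Unset Printing Implicit Defensive.

Import Order.TTheory GRing.Theory Num.Theory.
Local Open Scope ring_scope.

Lemma min_cost_le (R : realType) (V : finType) (f g : {set V} -> R) (tau : R) :
  min_cost f g tau <= g [set: V].
Proof. by rewrite /min_cost bigmin_idl ge_min lexx. Qed.

Lemma min_cost_attained (R : realType) (V : finType) (f g : {set V} -> R)
    (tau : R) :
  nondecreasing_fun g -> (exists T : {set V}, tau <= f T) ->
  exists2 T : {set V}, tau <= f T & g T = min_cost f g tau.
Proof.
move=> g_mono [T0 hT0].
(* The default value [g [set: V]] of the minimum dominates every candidate, so the minimum is
   reached at an actual [T]. *)
have g_leT T : tau <= f T -> g T <= g [set: V].
  by move=> _; apply: g_mono; apply: subsetT.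
by have [T hT eqT] := eq_bigmin (x := g [set: V]) T0 _ g hT0 g_leT; exists T.
Qed.

Lemma OPT_ge (R : realType) (V : finType) (f g : {set V} -> R) (tau B : R) :
  nondecreasing_fun g -> (exists T : {set V}, tau <= f T) ->
  min_cost f g tau <= B -> tau <= OPT f g B.
Proof.
move=> g_mono feas leB; have [T hT gT] := min_cost_attained g_mono feas.
by apply: (le_trans hT); apply: le_bigmax_cond; rewrite gT.
Qed.

(* A negative [beta] would contradict [g >= 0] at the budget [1]. *)
Lemma bicriteria_beta_ge0 (R : realType) (V : finType) (f g : {set V} -> R)
    (alpha beta : R) (alg : R -> {set V}) :
  nonneg_fun g -> bicriteria f g alpha beta alg -> 0 <= beta.
Proof.
move=> g_ge0 /(_ 1 ler01) [_]; rewrite mulr1.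
exact: le_trans (g_ge0 _).
Qed.

Lemma probe_success (R : realType) (V : finType) (f g : {set V} -> R)
    (alpha beta tau B : R) (alg : R -> {set V}) :
  nonneg_fun f -> nondecreasing_fun g -> bicriteria f g alpha beta alg ->
  0 < tau -> (exists T : {set V}, tau <= f T) ->
  0 <= B -> min_cost f g tau <= B -> alpha * tau <= f (alg B).
Proof.
move=> f_ge0 g_mono alg_bi tau_gt0 feas B_ge0 leB.
(* The sign of [alpha] is not given. If it is negative, the threshold [alpha * tau] is at most 0 and
   [f_ge0] suffices. *)
have [alpha_ge0|alpha_lt0] := leP 0 alpha.
  have [+ _] := alg_bi _ B_ge0; apply: le_trans.
  by apply: ler_wpM2l => //; apply: OPT_ge.
by apply: le_trans (f_ge0 _); apply: mulr_le0_ge0; apply: ltW.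
Qed.

Section SearchTermination.
Variables (R : realType) (V : finType) (f : {set V} -> R).
Variables (alpha tau eps : R) (alg : R -> {set V}).
Notation step := (search_step f alpha tau alg).

Lemma search_step_width (s : search_state R V) :
  hi (step s) - lo (step s) = (hi s - lo s) / 2.
Proof. by rewrite /search_step; case: ifP => _ /=; field. Qed.

Lemma search_run_preserves (P : search_state R V -> Prop)
    (s s' : search_state R V) :
  (forall t, P t -> P (step t)) ->
  search_run f alpha tau eps alg s s' -> P s -> P s' /\ hi s' - lo s' <= eps.
Proof.
move=> stepP; elim=> {s s'} [s stop Ps|s s' _ _ IH Ps]; first by split.
by apply: IH; apply: stepP.
Qed.

(** Each step halves the width, so an interval of width at most [eps * 2 ^+ n] needs at most [n]
    steps, by induction on [n]. *)
Lemma search_run_terminates (s : search_state R V) :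
  0 < eps -> exists s', search_run f alpha tau eps alg s s'.
Proof.
move=> eps_gt0.
suff runs n t : hi t - lo t <= eps * 2 ^+ n ->
    exists s', search_run f alpha tau eps alg t s'.
  (* The Archimedean bound [n] of a real [x] satisfies [x < 2 ^+ n]. *)
  apply: (runs (Num.bound ((hi s - lo s) / eps))).
  by rewrite mulrC -ler_pdivrMr //; apply/ltW/upper_nthrootP.
elim: n t => [|n IH] t width; first by exists t; constructor; rewrite mulr1 in width.
have [stop|go] := leP (hi t - lo t) eps; first by exists t; constructor.
have [|s' run] := IH (step t).
  by rewrite search_step_width ler_pdivrMr // -mulrA -exprSr.
by exists s'; apply: search_loop.
Qed.

End SearchTermination.

Section SearchInvariant.
Variables (R : realType) (V : finType) (f g : {set V} -> R).
Variables (alpha beta tau : R) (alg : R -> {set V}).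

(** Phrasing it through [search_output] covers the states with nothing recorded. The bound
    [0 <= lo s] keeps every probed budget nonnegative, as [bicriteria] requires. *)
Definition search_inv (s : search_state R V) : Prop :=
  [/\ 0 <= lo s <= hi s, lo s <= min_cost f g tau,
      alpha * tau <= f (search_output alg s)
    & g (search_output alg s) <= beta * hi s].

Hypotheses (f_ge0 : nonneg_fun f) (g_mono : nondecreasing_fun g).
Hypotheses (alg_bi : bicriteria f g alpha beta alg) (tau_gt0 : 0 < tau).
Hypothesis feas : exists T : {set V}, tau <= f T.

Lemma search_inv_init :
  0 <= min_cost f g tau -> search_inv (search_init g).
Proof.
move=> Bstar_ge0; have leV := min_cost_le f g tau.
have V_ge0 := le_trans Bstar_ge0 leV.
split; rewrite /= ?lexx //; last by case: (alg_bi V_ge0).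
(* Nothing is recorded yet, so the output is the answer at the budget [g [set: V]], which is at
   least B*. *)
exact: (probe_success f_ge0 g_mono alg_bi).
Qed.

Lemma search_inv_step (s : search_state R V) :
  search_inv s -> search_inv (search_step f alpha tau alg s).
Proof.
case=> /andP[lo_ge0 le_lo_hi] lo_le out_f out_g.
have mid_ge0 : 0 <= (lo s + hi s) / 2 by lra.
rewrite /search_step; case: ifPn => [ok|fail]; split=> //=.
- by apply/andP; split=> //; lra.
- by case: (alg_bi mid_ge0).
- by apply/andP; split=> //; lra.
(* By contraposition: a midpoint above B* would have given a successful probe. *)
- apply: contraNT fail; rewrite -ltNge => /ltW.
  exact: (probe_success f_ge0 g_mono alg_bi).
Qed.

End SearchInvariant.

Theorem mainTheorem9 (R : realType) (V : finType) (f g : {set V} -> R)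
    (alpha beta tau eps : R) (alg : R -> {set V})
    (f_ge0 : nonneg_fun f) (f_mono : nondecreasing_fun f)
    (f_sub : submodular f)
    (g_ge0 : nonneg_fun g) (g_mono : nondecreasing_fun g)
    (g_super : supermodular g)
    (alg_bicriteria : bicriteria f g alpha beta alg)
    (tau_gt0 : 0 < tau) (tau_feasible : exists T : {set V}, tau <= f T)
    (Bstar_gt0 : 0 < min_cost f g tau)
    (eps_gt0 : 0 < eps) :
  exists s : search_state R V,
    search_run f alpha tau eps alg (search_init g) s /\
    alpha * tau <= f (search_output alg s) /\
    g (search_output alg s)
      <= beta * (1 + eps / min_cost f g tau) * min_cost f g tau.
Proof.
have [s run] := search_run_terminates f alpha tau alg (search_init g) eps_gt0.
exists s; split=> //.
have inv_step :=
  search_inv_step f_ge0 g_mono alg_bicriteria tau_gt0 tau_feasible.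
have inv_init := search_inv_init f_ge0 g_mono alg_bicriteria tau_gt0
  tau_feasible (ltW Bstar_gt0).
have [[_ lo_le out_f out_g] width] :=
  search_run_preserves inv_step run inv_init.
split=> //; apply: (le_trans out_g).
(* Since B* is nonzero, the target equals [beta * (min_cost f g tau + eps)]. *)
rewrite -mulrA mulrDl mul1r divfK ?gt_eqF //.
apply: ler_wpM2l; first exact: bicriteria_beta_ge0 alg_bicriteria.
by lra.
Qed.
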